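(* (i) Saturated bisimilarity implies $\mathrm{true}$-conditional bisimilarity: ${\sim_C}\subseteq{\simeq_T}$. (ii) The converse fails in general: there exist a category $\mathbf C$ with distinguished object $0$, a representative class of squares $\kappa$, a conditional reactive system $\mathcal S$ and arrows $a,b\colon 0\to J$ with $(a,b)\in{\simeq_T}$ but $(a,b)\notin{\sim_C}$.
   Context: Composition of $f\colon A\to B$, $g\colon B\to C$ is written $f;g$. Fix a category $\mathbf C$ with distinguished object $0$ and a representative class $\kappa$ of commuting squares: for every commuting square $\alpha_1;\delta_1=\alpha_2;\delta_2$ there are $(\alpha_1,\alpha_2,\beta_1,\beta_2)\in\kappa$ (a commuting square) and $\gamma$ with $\delta_1=\beta_1;\gamma$, $\delta_2=\beta_2;\gamma$; $\kappa(\alpha_1,\alpha_2)$ is the set of $(\beta_1,\beta_2)$ with $(\alpha_1,\alpha_2,\beta_1,\beta_2)\in\kappa$. Conditions over $A$ are defined inductively as $(A,\mathcal Q,S)$, $\mathcal Q\in\{\forall,\exists\}$, $S$ a finite set of pairs $(h,\mathcal A')$ with $h\colon A\to A'$, $\mathcal A'$ a condition over $A'$; $\mathrm{true}_A=(A,\forall,\emptyset)$. For $a\colon A\to B$: $a\models(A,\forall,S)$ iff for all $(h,\mathcal A')\in S$ and all $g$ with $a=h;g$, $g\models\mathcal A'$; $a\models(A,\exists,S)$ iff some $(h,\mathcal A')\in S$ and $g$ satisfy $a=h;g$, $g\models\mathcal A'$. $\mathcal A\models\mathcal B$: every arrow satisfying $\mathcal A$ satisfies $\mathcal B$. Boolean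 connectives have the standard semantics. Shift along $c\colon A\to B$: $(A,\mathcal Q,S)_{\downarrow c}=(B,\mathcal Q,\{(\beta,\mathcal A'_{\downarrow\alpha})\mid(h,\mathcal A')\in S,(\alpha,\beta)\in\kappa(h,c)\})$; it satisfies $c;d\models\mathcal A\iff d\models\mathcal A_{\downarrow c}$. A conditional reactive system is a set $\mathcal S$ of rules $(\ell,r,\mathcal R)$, $\ell,r\colon0\to I$, $\mathcal R$ a condition over $I$. Context step $a\xrightarrow[C]{f,\ \mathcal A}a'$ ($a\colon0\to J$, $f\colon J\to K$, $a'\colon0\to K$, $\mathcal A$ over $K$): there are a rule $(\ell,r,\mathcal R)\in\mathcal S$ and $c\colon I\to K$ with $a;f=\ell;c$, $a'=r;c$, $\mathcal A\models\mathcal R_{\downarrow c}$. $\mathcal D\models\bigvee_{i\in I}\mathcal E_i$ (possibly infinite $I$): every arrow satisfying $\mathcal D$ satisfies some $\mathcal E_i$. A saturated bisimulation is a binary relation $R$ on pairs of arrows $a,b\colon0\to J$ such that for all $(a,b)\in R$ and every context step $a\xrightarrow[C]{f,\ \mathcal A}a'$ there are finitely many context steps $b\xrightarrow[C]{f,\ \mathcal B_i}b'_i$, $i\in I$, with $(a',b'_i)\in R$ and $\mathcal A\models\bigvee_{i\in I}\mathcal B_i$, and symmetrically for context steps of $b$; saturated bisimilarity $\sim_C$ is the union of all saturated bisimulations. A conditional relation is a set of triples $(a,b,\mathcal C)$, $a,b\colon0\to J$, $\mathcal C$ a condition over $J$. A conditional bisimulation is a conditional relation $R$ such that for each $(a,b,\mathcal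 C)\in R$ and each context step $a\xrightarrow[C]{f,\ \mathcal A}a'$ there are a (possibly infinite) index set $I$, context steps $b\xrightarrow[C]{f,\ \mathcal B_i}b'_i$ and conditions $\mathcal C'_i$ with $(a',b'_i,\mathcal C'_i)\in R$ and $\mathcal A\land\mathcal C_{\downarrow f}\models\bigvee_{i\in I}(\mathcal C'_i\land\mathcal B_i)$, and symmetrically for context steps of $b$; $\simeq_C$ is the set of triples in some conditional bisimulation, and ${\simeq_T}=\{(a,b)\mid a,b\colon0\to J,\ (a,b,\mathrm{true}_J)\in{\simeq_C}\}$. *)

(* Defs.v *)
From Stdlib Require Import List FinFun.

Set Implicit Arguments.
Unset Strict Implicit.
Unset Printing Implicit Defensive.

(** * Categories, with composition written in diagrammatic order *)

Record category : Type := Category {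
  Ob :> Type;
  Hom : Ob -> Ob -> Type;
  idm : forall A : Ob, Hom A A;
  comp : forall A B D : Ob, Hom A B -> Hom B D -> Hom A D;
  comp_idl : forall (A B : Ob) (f : Hom A B), comp (idm A) f = f;
  comp_idr : forall (A B : Ob) (f : Hom A B), comp f (idm B) = f;
  comp_assoc : forall (A B D E : Ob) (f : Hom A B) (g : Hom B D) (h : Hom D E),
    comp (comp f g) h = comp f (comp g h) }.

Arguments Hom {c} _ _.
Arguments idm {c} A.
Arguments comp {c A B D} _ _.

Notation "f ;; g" := (comp f g) (at level 50, left associativity).

(** * Representative classes of commuting squares *)

Record cospan (C : category) (B D : C) : Type := Cospan {
  apex : C;
  leg1 : Hom B apex;
  leg2 : Hom D apex }.

(** [kappa a1 a2] enumerates the pairs [(b1, b2)] for which [(a1, a2, b1, b2)]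
    is in the class. These sets have to be finite for the shift of a condition
    to be again a (finite) condition; order and repetitions play no role. *)
Record repr_class (C : category) : Type := ReprClass {
  kappa : forall A B D : C, Hom A B -> Hom A D -> list (cospan B D);
  kappa_commutes : forall (A B D : C) (a1 : Hom A B) (a2 : Hom A D) (s : cospan B D),
    In s (kappa a1 a2) -> a1 ;; leg1 s = a2 ;; leg2 s;
  kappa_represents :
    forall (A B D E : C) (a1 : Hom A B) (a2 : Hom A D) (d1 : Hom B E) (d2 : Hom D E),
    a1 ;; d1 = a2 ;; d2 ->
    exists2 s : cospan B D, In s (kappa a1 a2) &
      exists g : Hom (apex s) E, d1 = leg1 s ;; g /\ d2 = leg2 s ;; g }.

Arguments kappa {C} _ {A B D} _ _.
Arguments kappa_commutes {C} _ {A B D a1 a2 s} _.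
Arguments kappa_represents {C} _ {A B D E a1 a2 d1 d2} _.

(** * Conditions *)

Inductive quantifier : Set := Univ | Exis.

(** The finite set of pairs [(h, A')] is represented by a list. *)
Inductive cond (C : category) (A : C) : Type :=
  Cond : quantifier -> list {A' : C & (Hom A A' * cond A')%type} -> cond A.

Arguments Cond {C A} _ _.

Definition ctrue (C : category) (A : C) : cond A := Cond Univ nil.

(** The conjunction resp. disjunction over the list is computed by [fold_right]
    to make the recursion structural; [sat_univ] and [sat_exis] below restate
    the two cases with membership. *)
Fixpoint sat (C : category) (A B : C) (a : Hom A B) (K : cond A) {struct K} : Prop :=
  match K with
  | Cond Univ ps =>
      fold_right and True
        (map (fun p => match p with
           | existT _ A' (h, K') => forall g : Hom A' B, a = h ;; g -> sat g K'
           end) ps)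
  | Cond Exis ps =>
      fold_right or False
        (map (fun p => match p with
           | existT _ A' (h, K') => exists g : Hom A' B, a = h ;; g /\ sat g K'
           end) ps)
  end.

Lemma sat_univ (C : category) (A B : C) (a : Hom A B)
    (ps : list {A' : C & (Hom A A' * cond A')%type}) :
  sat a (Cond Univ ps) <->
  forall (A' : C) (h : Hom A A') (K' : cond A'), In (existT _ A' (h, K')) ps ->
    forall g : Hom A' B, a = h ;; g -> sat g K'.
Proof.
simpl; induction ps as [|[A0 [h0 K0]] ps IH]; simpl.
- split; [intros _ A' h K' []|auto].
- rewrite IH; split.
  + intros [H0 H] A' h K' [E|E]; [|now apply H].
    change (let p := existT (fun A' : C => (Hom A A' * cond A')%type) A' (h, K') in
      match p with
      | existT _ A' (h, K') => forall g : Hom A' B, a = h ;; g -> sat g K'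
      end).
    rewrite <- E; exact H0.
  + intros H; split; [apply (H A0 h0 K0); now left|].
    intros A' h K' E; apply H; now right.
Qed.

Lemma sat_exis (C : category) (A B : C) (a : Hom A B)
    (ps : list {A' : C & (Hom A A' * cond A')%type}) :
  sat a (Cond Exis ps) <->
  exists (A' : C) (h : Hom A A') (K' : cond A'), In (existT _ A' (h, K')) ps /\
    exists g : Hom A' B, a = h ;; g /\ sat g K'.
Proof.
simpl; induction ps as [|[A0 [h0 K0]] ps IH]; simpl.
- split; [intros []|now intros (A' & h & K' & [] & _)].
- rewrite IH; split.
  + intros [H|(A' & h & K' & E & H)].
    * exists A0, h0, K0; auto.
    * exists A', h, K'; auto.
  + intros (A' & h & K' & [E|E] & H); [left|right; exists A', h, K'; auto].
    change (let p := existT (fun A' : C => (Hom A A' * cond A')%type) A0 (h0, K0) in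
      match p with
      | existT _ A' (h, K') => exists g : Hom A' B, a = h ;; g /\ sat g K'
      end).
    rewrite E; exact H.
Qed.

Fixpoint shift (C : category) (k : repr_class C) (A B : C) (c : Hom A B) (K : cond A)
    {struct K} : cond B :=
  match K with
  | Cond q ps =>
      Cond q (flat_map (fun p => match p with
        | existT _ A' (h, K') =>
            map (fun s : cospan A' B =>
                   existT (fun D : C => (Hom B D * cond D)%type) (apex s)
                     (leg2 s, shift k (leg1 s) K'))
                (kappa k h c)
        end) ps)
  end.

(** * Entailment and Boolean connectives

    Boolean combinations of conditions over [A] matter only through the arrows
    out of [A] satisfying them, so they are formed as predicates on such arrows. *)

Definition arrow_pred (C : category) (A : C) : Type := forall B : C, Hom A B -> Prop.

Definition models (C : category) (A : C) (K : cond A) : arrow_pred A :=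
  fun B a => sat a K.

Definition pand (C : category) (A : C) (P Q : arrow_pred A) : arrow_pred A :=
  fun B a => P B a /\ Q B a.

Definition por (C : category) (A : C) (I : Type) (P : I -> arrow_pred A) : arrow_pred A :=
  fun B a => exists i : I, P i B a.

Definition entails (C : category) (A : C) (P Q : arrow_pred A) : Prop :=
  forall (B : C) (a : Hom A B), P B a -> Q B a.

(** * Conditional reactive systems *)

Record rule (C : category) (zero : C) : Type := Rule {
  interface : C;
  lhs : Hom zero interface;
  rhs : Hom zero interface;
  app_cond : cond interface }.

Definition reactive_system (C : category) (zero : C) : Type := rule zero -> Prop.

Definition context_step (C : category) (zero : C) (k : repr_class C)
    (S : reactive_system zero) (J K : C)
    (a : Hom zero J) (f : Hom J K) (A : cond K) (a' : Hom zero K) : Prop :=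
  exists2 rho : rule zero, S rho &
    exists c : Hom (interface rho) K,
      a ;; f = lhs rho ;; c /\ a' = rhs rho ;; c /\
      entails (models A) (models (shift k c (app_cond rho))).

(** * Saturated bisimilarity *)

Definition arrow_rel (C : category) (zero : C) : Type :=
  forall J : C, Hom zero J -> Hom zero J -> Prop.

Definition saturated_bisimulation (C : category) (zero : C) (k : repr_class C)
    (S : reactive_system zero) (R : arrow_rel zero) : Prop :=
  forall (J : C) (a b : Hom zero J), R J a b ->
    (forall (K : C) (f : Hom J K) (A : cond K) (a' : Hom zero K),
       context_step k S a f A a' ->
       exists (I : Type) (B : I -> cond K) (b' : I -> Hom zero K),
         Finite I /\
         (forall i : I, context_step k S b f (B i) (b' i) /\ R K a' (b' i)) /\
         entails (models A) (por (fun i => models (B i)))) /\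
    (forall (K : C) (f : Hom J K) (B : cond K) (b' : Hom zero K),
       context_step k S b f B b' ->
       exists (I : Type) (A : I -> cond K) (a' : I -> Hom zero K),
         Finite I /\
         (forall i : I, context_step k S a f (A i) (a' i) /\ R K (a' i) b') /\
         entails (models B) (por (fun i => models (A i)))).

Definition saturated_bisimilar (C : category) (zero : C) (k : repr_class C)
    (S : reactive_system zero) (J : C) (a b : Hom zero J) : Prop :=
  exists2 R : arrow_rel zero, saturated_bisimulation k S R & R J a b.

(** * Conditional bisimilarity *)

Definition cond_rel (C : category) (zero : C) : Type :=
  forall J : C, Hom zero J -> Hom zero J -> cond J -> Prop.

Definition conditional_bisimulation (C : category) (zero : C) (k : repr_class C)
    (S : reactive_system zero) (R : cond_rel zero) : Prop :=
  forall (J : C) (a b : Hom zero J) (G : cond J), R J a b G ->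
    (forall (K : C) (f : Hom J K) (A : cond K) (a' : Hom zero K),
       context_step k S a f A a' ->
       exists (I : Type) (B : I -> cond K) (b' : I -> Hom zero K) (G' : I -> cond K),
         (forall i : I, context_step k S b f (B i) (b' i) /\ R K a' (b' i) (G' i)) /\
         entails (pand (models A) (models (shift k f G)))
                 (por (fun i => pand (models (G' i)) (models (B i))))) /\
    (forall (K : C) (f : Hom J K) (B : cond K) (b' : Hom zero K),
       context_step k S b f B b' ->
       exists (I : Type) (A : I -> cond K) (a' : I -> Hom zero K) (G' : I -> cond K),
         (forall i : I, context_step k S a f (A i) (a' i) /\ R K (a' i) b' (G' i)) /\
         entails (pand (models B) (models (shift k f G)))
                 (por (fun i => pand (models (G' i)) (models (A i))))).

Definition conditionally_bisimilar (C : category) (zero : C) (k : repr_class C)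
    (S : reactive_system zero) (J : C) (a b : Hom zero J) (G : cond J) : Prop :=
  exists2 R : cond_rel zero, conditional_bisimulation k S R & R J a b G.

Definition true_bisimilar (C : category) (zero : C) (k : repr_class C)
    (S : reactive_system zero) (J : C) (a b : Hom zero J) : Prop :=
  conditionally_bisimilar k S a b (ctrue J).

(* Main.v *)
Require Import Defs.
From Stdlib Require Import List FinFun Arith Lia Bool.
Import ListNotations.

(** A saturated bisimulation is a conditional one once every pair is labelled
    with [true]. For the converse, extend the poset of natural numbers by an
    object with exactly two arrows to every number, [true] and [false]. The
    state [true] has an unconditional loop; the state [false] has, for every
    [n], a loop restricted to environments ending below [n]. Every environment
    admits one of the latter loops, but finitely many of them miss some
    environment, so only a conditional bisimulation, where the answers may be
    infinite in number, relates the two states. *)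

Lemma sat_ctrue (C : category) (A B : C) (a : Hom A B) : sat a (ctrue A).
Proof. exact I. Qed.

Lemma saturated_true_bisimilar (C : category) (zero : C) (k : repr_class C)
    (S : reactive_system zero) (J : C) (a b : Hom zero J) :
  saturated_bisimilar k S a b -> true_bisimilar k S a b.
Proof.
intros [R HR Rab].
exists (fun J a b G => R J a b /\ G = ctrue J); [|now split].
intros J' a' b' G [Rab' ->].
destruct (HR _ _ _ Rab') as [Ha Hb]; split.
- intros K f A a1 Hstep.
  destruct (Ha _ _ _ _ Hstep) as (I & B & b1 & _ & HI & Hent).
  exists I, B, b1, (fun _ => ctrue K); split.
  + intros i; destruct (HI i) as [H1 H2]; auto.
  + intros L d [HA _]; destruct (Hent _ _ HA) as [i Hi].
    exists i; split; [apply sat_ctrue|exact Hi].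
- intros K f B b1 Hstep.
  destruct (Hb _ _ _ _ Hstep) as (I & A & a1 & _ & HI & Hent).
  exists I, A, a1, (fun _ => ctrue K); split.
  + intros i; destruct (HI i) as [H1 H2]; auto.
  + intros L d [HB _]; destruct (Hent _ _ HB) as [i Hi].
    exists i; split; [apply sat_ctrue|exact Hi].
Qed.

(** [Cond Exis []] holds for no arrow, so exactly the arrows factoring through [h] are excluded. *)
Definition avoids {C : category} {A B : C} (h : Hom A B) : cond A :=
  Cond Univ [existT (fun A' : C => (Hom A A' * cond A')%type) B (h, Cond Exis [])].

(** A factorization of [c ;; d] through [h] closes a square, and [kappa] represents it by a square
    through whose second leg [d] factors. Conversely, such a factorization of [d], precomposed with
    the first leg, gives one of [c ;; d] through [h]. *)
Lemma sat_shift_avoids (C : category) (k : repr_class C) (A B D E : C)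
    (h : Hom A B) (c : Hom A D) (d : Hom D E) :
  sat d (shift k c (avoids h)) <-> forall g : Hom B E, c ;; d <> h ;; g.
Proof.
unfold avoids; cbn [shift flat_map]; rewrite app_nil_r, sat_univ; split.
- intros H g Hg.
  destruct (kappa_represents k (eq_sym Hg)) as [s Hs (g' & _ & Hd)].
  refine (H _ _ (Cond Exis []) _ g' Hd).
  apply in_map_iff; exists s; split; [reflexivity|exact Hs].
- intros H A' h' K' Hin g Hg.
  apply in_map_iff in Hin; destruct Hin as (s & Es & Hs).
  (* Transporting a property along the equation [Es] of dependent pairs avoids injectivity of
     [existT]. *)
  assert (Hd : exists g' : Hom (apex s) E, d = leg2 s ;; g').
  { assert (P : match existT (fun A' : C => (Hom D A' * cond A')%type) A' (h', K') with
                | existT _ X (x, _) => exists g' : Hom X E, d = x ;; g'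
                end) by (exists g; exact Hg).
    rewrite <- Es in P; exact P. }
  destruct Hd as [g' ->].
  destruct (H (leg1 s ;; g')).
  now rewrite <- !comp_assoc, (kappa_commutes k Hs).
Qed.

Definition chain_hom (A B : option nat) : Type :=
  match A, B with
  | None, None => unit
  | None, Some _ => bool
  | Some _, None => Empty_set
  | Some n, Some m => n <= m
  end.

Definition chain_id (A : option nat) : chain_hom A A :=
  match A with None => tt | Some n => le_n n end.

Definition chain_comp (A B D : option nat) :
    chain_hom A B -> chain_hom B D -> chain_hom A D :=
  match A, B, D with
  | None, None, _ => fun _ g => g
  | None, Some _, Some _ => fun x _ => x
  | Some n, Some m, Some p => fun f g => Nat.le_trans n m p f g
  | Some _, None, _ => fun f _ => match f with end
  | _, Some _, None => fun _ g => match g with end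
  end.

Definition chain : category.
Proof.
refine (@Category (option nat) chain_hom chain_id chain_comp _ _ _).
- intros [n|] [m|] f; simpl in *; try easy; try apply le_unique.
- intros [n|] [m|] f; simpl in *; try easy; try apply le_unique; now destruct f.
- intros [n|] [m|] [p|] [q|] f g h; simpl in *; try easy; apply le_unique.
Defined.

Definition chain_join (m p : nat) : @cospan chain (Some m) (Some p) :=
  @Cospan chain (Some m) (Some p) (Some (max m p)) (Nat.le_max_l m p) (Nat.le_max_r m p).

(** Two numbers meet at their maximum. Different bits admit no completion, hence the empty list. A
    leg into [None] is an identity, so the other leg closes the square. *)
Definition chain_kappa (A B D : chain) : Hom A B -> Hom A D -> list (cospan B D) :=
  match A, B, D return @Hom chain A B -> @Hom chain A D -> list (@cospan chain B D) with
  | None, None, D => fun _ g => [@Cospan chain None D D g (idm D)]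
  | None, Some m, None => fun f _ => [@Cospan chain (Some m) None (Some m) (idm (Some m : chain)) f]
  | None, Some m, Some p => fun x y => if Bool.eqb x y then [chain_join m p] else []
  | Some _, Some m, Some p => fun _ _ => [chain_join m p]
  | Some _, None, _ => fun f _ => match f with end
  | Some _, Some _, None => fun _ g => match g with end
  end.

Lemma chain_join_represents (m p : nat) (E : chain)
    (d1 : @Hom chain (Some m) E) (d2 : @Hom chain (Some p) E) :
  exists g : Hom (apex (chain_join m p)) E,
    d1 = leg1 (chain_join m p) ;; g /\ d2 = leg2 (chain_join m p) ;; g.
Proof.
destruct E as [e|]; [|destruct d1].
exists (Nat.max_lub m p e d1 d2); split; apply le_unique.
Qed.

Definition chain_repr : repr_class chain.
Proof.
refine (@ReprClass chain chain_kappa _ _).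
- intros [n|] [m|] [p|] a1 a2 s; simpl in *; try easy.
  + intros [<-|[]]; apply le_unique.
  + destruct (eqb_spec a1 a2) as [->|_]; [|easy].
    now intros [<-|[]].
  + now intros [<-|[]]; destruct a2.
  + now intros [<-|[]].
  + now intros [<-|[]]; destruct a2.
- intros [n|] B D E a1 a2 d1 d2 H.
  + destruct B as [m|]; [|destruct a1]; destruct D as [p|]; [|destruct a2].
    exists (chain_join m p); [now left|apply chain_join_represents].
  + destruct B as [m|].
    * destruct D as [p|].
      -- exists (chain_join m p); [|apply chain_join_represents].
         destruct E as [e|]; [|destruct d1].
         simpl in *; subst a2; rewrite eqb_reflx; now left.
      -- eexists; [now left|]; exists d1; split; [symmetry; apply comp_idl|].
         now destruct a2; destruct E as [e|]; [|destruct d1].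
    * eexists; [now left|]; exists d2; split; [|symmetry; apply comp_idl].
      now destruct a1.
Defined.

Definition state (b : bool) (j : nat) : @Hom chain None (Some j) := b.

(** An arrow from 0 to [l] factors through [n] exactly when [n <= l], so the environments ending
    below [n] remain. *)
Definition below (n : nat) : @cond chain (Some 0) :=
  avoids (Nat.le_0_l n : @Hom chain (Some 0) (Some n)).

(** Shifting changes where the environment starts, while the bound concerns only where it ends. *)
Lemma sat_shift_below (n i l : nat) (c : @Hom chain (Some 0) (Some i))
    (d : @Hom chain (Some i) (Some l)) :
  sat d (shift chain_repr c (below n)) <-> l < n.
Proof.
unfold below; rewrite sat_shift_avoids; split.
- intros H; destruct (le_lt_dec n l) as [Hle|]; [|easy].
  destruct (H Hle); apply le_unique.
- intros H g; simpl in g; lia.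
Qed.

Inductive loops : @reactive_system chain None :=
| loop_true : loops (Rule (state true 0) (state true 0) (ctrue (Some 0 : chain)))
| loop_false (n : nat) : loops (Rule (state false 0) (state false 0) (below n)).

Notation step := (context_step chain_repr loops).

Lemma step_true (j i : nat) (f : @Hom chain (Some j) (Some i)) (A : cond (Some i : chain)) :
  step (state true j) f A (state true i).
Proof.
eexists; [exact loop_true|].
exists (Nat.le_0_l i); repeat split.
Qed.

Lemma step_false (j i n : nat) (f : @Hom chain (Some j) (Some i)) :
  step (state false j) f
    (shift chain_repr (Nat.le_0_l i : @Hom chain (Some 0) (Some i)) (below n)) (state false i).
Proof.
eexists; [exact (loop_false n)|].
exists (Nat.le_0_l i); split; [reflexivity|split; [reflexivity|]].
intros L d Hd; exact Hd.
Qed.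

Lemma step_target (x : bool) (j i : nat) (f : @Hom chain (Some j) (Some i)) A a' :
  step (state x j) f A a' -> a' = state x i.
Proof.
intros [rho [|n] (c & H & -> & _)].
(* Composition with an arrow between numbers keeps the bit, so [H] computes to an equation of
   bits. *)
- change (x = true) in H; now subst x.
- change (x = false) in H; now subst x.
Qed.

(** A step uses a single rule, and [A] must entail the shifted condition of that rule. *)
Lemma step_false_bounded (j i : nat) (f : @Hom chain (Some j) (Some i)) A a' :
  step (state false j) f A a' ->
  exists n, forall l (d : @Hom chain (Some i) (Some l)), sat d A -> l < n.
Proof.
intros [rho [|n] (c & H & _ & HA)]; [discriminate H|].
exists n; intros l d Hd; apply HA in Hd.
now apply sat_shift_below in Hd.
Qed.

Definition states_related : @cond_rel chain None := fun J =>
  match J return @Hom chain None J -> @Hom chain None J -> @cond chain J -> Prop with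
  | None => fun _ _ _ => False
  | Some j => fun a b G => a = state true j /\ b = state false j /\ G = ctrue (Some j : chain)
  end.

Lemma states_true_bisimilar :
  true_bisimilar chain_repr loops (state true 0) (state false 0).
Proof.
exists states_related; [|now repeat split].
intros [j|] a b G; [|easy].
intros (-> & -> & ->); split; (intros [i|] f A a' Hstep; [|destruct f]);
  apply step_target in Hstep; subst a'.
(* All loops of [false] answer together, one per bound; an environment ending at [l] is covered by
   the answer with bound [S l]. *)
- exists nat, (fun n => shift chain_repr (Nat.le_0_l i : @Hom chain (Some 0) (Some i)) (below n)),
    (fun _ => state false i), (fun _ => ctrue (Some i : chain)).
  split; [intros n; split; [apply step_false|now repeat split]|].
  intros [l|] d _; [|destruct d].
  exists (S l); split; [apply sat_ctrue|].
  apply sat_shift_below; lia.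
(* In the other direction the unconditional loop alone covers every environment. *)
- exists unit, (fun _ => ctrue (Some i : chain)),
    (fun _ => state true i), (fun _ => ctrue (Some i : chain)).
  split; [intros n; split; [apply step_true|now repeat split]|].
  intros L d _; exists tt; split; apply sat_ctrue.
Qed.

(** Finitely many bounds have a maximum; finiteness of the set of answers enters here. *)
Lemma uniform_bound (I : Type) (P : I -> nat -> Prop) (s : list I) :
  (forall i, exists n, forall l, P i l -> l < n) ->
  exists n, forall i, In i s -> forall l, P i l -> l < n.
Proof.
intros H; induction s as [|i s [n Hn]]; [now exists 0|].
destruct (H i) as [m Hm]; exists (max n m).
intros i' [<-|Hi'] l Hl; [apply Hm in Hl|apply (Hn _ Hi') in Hl]; lia.
Qed.

Lemma states_not_saturated_bisimilar :
  ~ saturated_bisimilar chain_repr loops (state true 0) (state false 0).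
Proof.
intros [R HR Rab].
destruct (HR _ _ _ Rab) as [Ha _].
(* The challenge is the loop in the identity context under [ctrue], which leaves every environment
   to be covered. *)
destruct (Ha _ _ _ _ (step_true 0 0 (le_n 0) (ctrue _))) as (I & B & b' & [s Hs] & HI & Hent).
destruct (uniform_bound I (fun i l => exists d : @Hom chain (Some 0) (Some l), sat d (B i)) s)
  as [n Hn].
- intros i; destruct (HI i) as [Hstep _].
  destruct (step_false_bounded _ _ _ _ _ Hstep) as [n Hn].
  exists n; intros l [d Hd]; exact (Hn l d Hd).
(* The environment ending at the common bound [n] itself satisfies none of the answers. *)
- destruct (Hent (Some n) (Nat.le_0_l n) (sat_ctrue _ _ _ _)) as [i Hi].
  apply (Nat.lt_irrefl n), (Hn i (Hs i)); eexists; exact Hi.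
Qed.

Theorem theorem6p5 :
  (forall (C : category) (zero : C) (k : repr_class C) (S : reactive_system zero)
          (J : C) (a b : Hom zero J),
     saturated_bisimilar k S a b -> true_bisimilar k S a b) /\
  (exists (C : category) (zero : C) (k : repr_class C) (S : reactive_system zero)
          (J : C) (a b : Hom zero J),
     true_bisimilar k S a b /\ ~ saturated_bisimilar k S a b).
Proof.
split; [exact saturated_true_bisimilar|].
exists chain, None, chain_repr, loops, (Some 0), (state true 0), (state false 0).
split; [exact states_true_bisimilar|exact states_not_saturated_bisimilar].
Qed.
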